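(* Let $\mathbf{M}=(M;\le,0,1)$ be a non-trivial complete lattice, let $S$ and $X$ be non-empty sets, and let $R\subseteq X\times S\times S$. Let $\mathbf{B}=(B;\le,0,1)$ be a bounded subposet of $\mathbf{M}^{S}$, and let $T_R=(T_{R_x})_{x\in X}\colon B\to (M^S)^X$ and $P_R=(P_{R_x})_{x\in X}\colon B\to (M^S)^X$ be the labelled upper and lower transition functors constructed by means of $R$. Then for all $a,b\in B$ and all $x\in X$, $$P_{R_x}(a)\le b\iff a\le T_{R_x}(b).$$ Moreover: (a) If $R=R_{T_R}$ and $T_{R_x}(b)\in B$ for all $x\in X$, $b\in B$, then $R=R_{T_R}=R^{P_R}$. (b) If $R=R^{P_R}$ and $P_{R_x}(b)\in B$ for all $x\in X$, $b\in B$, then $R=R_{T_R}=R^{P_R}$.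
   Context: $\mathbf{M}^S$ is the set of maps $S\to M$ ordered pointwise; a bounded subposet of $\mathbf{M}^S$ is a subset containing the constant maps $0,1$ with the induced order; $p(s)$ denotes the value of $p\in M^S$ at $s$. For $x\in X$ let $R_x=\{(s,t)\in S\times S\mid (x,s,t)\in R\}$, so $R=\bigcup_{x\in X}\{x\}\times R_x$. For $b\in B$ and $s,t\in S$ define $T_{R_x}(b)(s)=\bigwedge_M\{b(u)\mid (s,u)\in R_x\}$ and $P_{R_x}(b)(t)=\bigvee_M\{b(u)\mid (u,t)\in R_x\}$ (empty meet $=1$, empty join $=0$). For a family $T=(T_x)_{x\in X}$ of maps $B\to M^S$ define $R_{T_x}=\{(s,t)\mid \forall b\in B:\ T_x(b)(s)\le b(t)\}$ and $R_T=\bigcup_{x\in X}\{x\}\times R_{T_x}$; for a family $P=(P_x)_{x\in X}$ define $R^{P_x}=\{(s,t)\mid \forall a\in B:\ a(s)\le P_x(a)(t)\}$ and $R^{P}=\bigcup_{x\in X}\{x\}\times R^{P_x}$. Thus $R_{T_R}$ and $R^{P_R}$ are these relations for $T=T_R$ and $P=P_R$. *)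

(* Defs.v *)
From mathcomp Require Import all_boot all_order.
From mathcomp Require Import boolp classical_sets.

Set Implicit Arguments.
Unset Strict Implicit.
Unset Printing Implicit Defensive.

Local Open Scope classical_set_scope.

(* M^S is the function type S -> M with the pointwise
   order of boolp; the order on a subset B of M^S is the one induced through
   val : B -> (S -> M). *)

Definition complete_lattice d (M : tbLatticeType d) : Prop :=
  forall A : set M, supremums A !=set0 /\ infimums A !=set0.

Definition bounded_subposet d (M : tbLatticeType d) (S : Type)
    (B : set (S -> M)) : Prop :=
  B (fun=> \bot%O) /\ B (fun=> \top%O).

Section Transition.
Context {d : Order.disp_t} {M : tbLatticeType d} {S : Type}.
Variable B : set (S -> M).

(* The default value of infimum (resp. supremum) is its value on the empty set:
   the empty meet is \top and the empty join is \bot. *)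
Definition upper_transition (Q : set (S * S)) (b : B) : S -> M :=
  fun s => infimum \top%O [set val b u | u in xsection Q s].

Definition lower_transition (Q : set (S * S)) (b : B) : S -> M :=
  fun t => supremum \bot%O [set val b u | u in ysection Q t].

Context {X : Type}.

(* A relation R on X x S x S is a set of pairs (x, (s, t)), so that
   xsection R x is R_x. *)
Definition labelled_upper_transition (R : set (X * (S * S))) :
    X -> B -> S -> M :=
  fun x => upper_transition (xsection R x).

Definition labelled_lower_transition (R : set (X * (S * S))) :
    X -> B -> S -> M :=
  fun x => lower_transition (xsection R x).

Definition upper_relation_at (T : B -> S -> M) : set (S * S) :=
  [set st | forall b : B, (T b st.1 <= val b st.2)%O].

Definition lower_relation_at (P : B -> S -> M) : set (S * S) :=
  [set st | forall a : B, (val a st.1 <= P a st.2)%O].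

Definition upper_relation (T : X -> B -> S -> M) : set (X * (S * S)) :=
  \bigcup_(x in [set: X]) ([set x] `*` upper_relation_at (T x)).

Definition lower_relation (P : X -> B -> S -> M) : set (X * (S * S)) :=
  \bigcup_(x in [set: X]) ([set x] `*` lower_relation_at (P x)).

End Transition.

(* Main.v *)
(* Both P_Q(a) <= b and a <= T_Q(b) say that a(s) <= b(t) for all (s,t) in Q,
   so P_Q is left adjoint to T_Q.  By the unit and counit of this adjunction Q is
   contained in both induced relations.  If T_Q(b) lies in B, testing the relation
   R^{P_Q} on a = T_Q(b) gives T_Q(b)(s) <= P_Q(T_Q(b))(t) <= b(t), so
   R^{P_Q} is contained in R_{T_Q}; dually when P_Q(a) lies in B. *)

Require Import Defs.
From mathcomp Require Import all_boot all_order.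
From mathcomp Require Import boolp classical_sets.

Local Open Scope classical_set_scope.

Import Order.TTheory.

Section CompleteLattice.
Context {d : Order.disp_t} {M : tbLatticeType d}.
Context (M_complete : complete_lattice M).

(** [supremum] returns its default on the empty set and otherwise chooses from [supremums A]. The
    default [\bot] is the least upper bound of the empty set, and completeness gives the choice
    something to pick. *)
Lemma supremum_supremums (A : set M) : supremums A (supremum \bot%O A).
Proof.
have [[x Ax] _] := M_complete A.
rewrite /supremum; case: ifP => [/eqP ->|_].
  by split=> [y []|y _]; last exact: le0x.
by case: xgetP => [y _ //|/(_ x)].
Qed.

Lemma infimum_infimums (A : set M) : infimums A (infimum \top%O A).
Proof.
have [_ [x Ax]] := M_complete A.
rewrite /infimum; case: ifP => [/eqP ->|_].
  by split=> [y []|y _]; last exact: lex1.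
by case: xgetP => [y _ //|/(_ x)].
Qed.

Lemma supremum_leP (A : set M) (m : M) :
  (supremum \bot%O A <= m)%O <-> ubound A m.
Proof.
have [A_le least] := supremum_supremums A.
by split=> [le_m y /A_le y_le|/least //]; apply: le_trans le_m.
Qed.

Lemma infimum_geP (A : set M) (m : M) :
  (m <= infimum \top%O A)%O <-> lbound A m.
Proof.
have [A_ge greatest] := infimum_infimums A.
by split=> [m_le y /A_ge|/greatest //]; apply: le_trans.
Qed.

Context {S : Type} {B : set (S -> M)}.
Implicit Types (Q : set (S * S)) (a b : B) (f : S -> M).

(** The join at [t] runs over the [Q]-predecessors of [t], so its universal property, taken over all
    [t], ranges over all pairs of [Q]. For [f := val b] this is the condition that the dual lemma
    gives for [f := val a]. *)
Lemma lower_transition_leP Q a f :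
  (lower_transition Q a <= f)%O <-> forall s t, Q (s, t) -> (val a s <= f t)%O.
Proof.
split=> [/lefP le_f s t Qst|le_f].
  by have /supremum_leP := le_f t; apply; exists s => //; apply/ysectionP.
by apply/lefP => t; apply/supremum_leP => _ [s /ysectionP Qst <-]; apply: le_f.
Qed.

Lemma upper_transition_geP Q b f :
  (f <= upper_transition Q b)%O <-> forall s t, Q (s, t) -> (f s <= val b t)%O.
Proof.
split=> [/lefP f_le s t Qst|f_le].
  by have /infimum_geP := f_le s; apply; exists t => //; apply/xsectionP.
by apply/lefP => s; apply/infimum_geP => _ [t /xsectionP Qst <-]; apply: f_le.
Qed.

Lemma lower_upper_adjoint Q a b :
  (lower_transition Q a <= val b)%O <-> (val a <= upper_transition Q b)%O.
Proof. by rewrite lower_transition_leP upper_transition_geP. Qed.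

(** This is [lower_transition_leP] at [f := lower_transition Q a], where the left side is
    reflexivity. *)
Lemma sub_lower_relation_at Q :
  Q `<=` lower_relation_at (@lower_transition d M S B Q).
Proof.
by move=> [s t] Qst a; apply: (lower_transition_leP Q a _).1 Qst.
Qed.

Lemma sub_upper_relation_at Q :
  Q `<=` upper_relation_at (@upper_transition d M S B Q).
Proof.
by move=> [s t] Qst b; apply: (upper_transition_geP Q b _).1 Qst.
Qed.

Lemma lower_sub_upper_relation_at Q :
  (forall b, B (upper_transition Q b)) ->
  lower_relation_at (@lower_transition d M S B Q) `<=`
  upper_relation_at (@upper_transition d M S B Q).
Proof.
move=> BT [s t] Pst b; pose Tb : B := SigSub (mem_set (BT b)).
apply: le_trans (Pst Tb) _.
(* The counit [P_Q(T_Q(b)) <= b], transposed from reflexivity of [T_Q(b)] and read at [t]. *)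
by have /lefP := (lower_upper_adjoint Q Tb b).2 (lexx _); apply.
Qed.

Lemma upper_sub_lower_relation_at Q :
  (forall a, B (lower_transition Q a)) ->
  upper_relation_at (@upper_transition d M S B Q) `<=`
  lower_relation_at (@lower_transition d M S B Q).
Proof.
move=> BP [s t] Tst a; pose Pa : B := SigSub (mem_set (BP a)).
apply: le_trans (Tst Pa).
(* The unit [a <= T_Q(P_Q(a))], read at [s]. *)
by have /lefP := (lower_upper_adjoint Q a Pa).1 (lexx _); apply.
Qed.

End CompleteLattice.

Section LabelledRelation.
Context {d : Order.disp_t} {M : tbLatticeType d} {S X : Type}.
Context {B : set (S -> M)}.

(** Only the index [x] contributes to the union at [(x, st)], so inclusions can be checked one label
    at a time. *)
Lemma upper_relationP (T : X -> B -> S -> M) x st :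
  upper_relation T (x, st) <-> upper_relation_at (T x) st.
Proof. by split=> [[_ _ [/= <-]]|Tst]; [|exists x]. Qed.

Lemma lower_relationP (P : X -> B -> S -> M) x st :
  lower_relation P (x, st) <-> lower_relation_at (P x) st.
Proof. by split=> [[_ _ [/= <-]]|Pst]; [|exists x]. Qed.

End LabelledRelation.

Theorem theorem3 (d : Order.disp_t) (M : tbLatticeType d) (S X : Type)
    (R : set (X * (S * S))) (B : set (S -> M))
    (M_complete : complete_lattice M) (M_nontrivial : \bot%O <> \top%O :> M)
    (S_nonempty : inhabited S) (X_nonempty : inhabited X)
    (B_bounded : bounded_subposet B) :
  let T_R : X -> B -> S -> M := labelled_upper_transition R in
  let P_R : X -> B -> S -> M := labelled_lower_transition R in
  (forall (a b : B) (x : X),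
     (P_R x a <= val b)%O <-> (val a <= T_R x b)%O) /\
  (R = upper_relation T_R -> (forall (x : X) (b : B), B (T_R x b)) ->
     R = upper_relation T_R /\ upper_relation T_R = lower_relation P_R) /\
  (R = lower_relation P_R -> (forall (x : X) (b : B), B (P_R x b)) ->
     R = upper_relation T_R /\ upper_relation T_R = lower_relation P_R).
Proof.
move=> T_R P_R; split; first by move=> a b x; apply: lower_upper_adjoint.
have R_sub_upper : R `<=` upper_relation T_R.
  move=> [x st] /xsectionP Rst; apply/upper_relationP.
  exact: sub_upper_relation_at.
have R_sub_lower : R `<=` lower_relation P_R.
  move=> [x st] /xsectionP Rst; apply/lower_relationP.
  exact: sub_lower_relation_at.
split=> [RT BT|RP BP].
  (* Rewriting with [RT] turns the first inclusion into [R_sub_lower]; the other is the one that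
     uses [BT]. *)
  split=> //; apply/seteqP; split; first by rewrite -RT.
  move=> [x st] /lower_relationP Pst; apply/upper_relationP.
  exact: (lower_sub_upper_relation_at M_complete _ (BT x) _ Pst).
have upper_lower : upper_relation T_R = lower_relation P_R.
  apply/seteqP; split; last by rewrite -RP.
  move=> [x st] /upper_relationP Tst; apply/lower_relationP.
  exact: (upper_sub_lower_relation_at M_complete _ (BP x) _ Tst).
by rewrite upper_lower.
Qed.
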